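(* Let $\lambda,\mu>0$ be such that $\lambda\mu<4$, let $T:\mathcal H\to\mathcal H$ be $\lambda$-RFNE and $U:\mathcal H\to\mathcal H$ be $\mu$-RFNE with $\operatorname{Fix}(UT)\neq\emptyset$, and let $\nu^*:=\frac{4(\lambda+\mu-\lambda\mu)}{4-\lambda\mu}$. Let $\tau:\mathcal H\to(0,+\infty)$ be a function such that, for some $z\in\operatorname{Fix}(UT)$ and all $x\notin\operatorname{Fix}(UT)$, $$\frac{\|a_1+b_1\|^2}{\frac1\lambda\|a_1-a_2\|^2+\frac1\mu\|b_1-b_2\|^2+\langle a_1-a_2,b_1-b_2\rangle}\le\tau(x)\le\nu^*,$$ where $a_1:=T(x)-x$, $a_2:=T(z)-z$, $b_1:=UT(x)-T(x)$, $b_2:=UT(z)-T(z)$. Let $x^0\in\mathcal H$ be arbitrary, let $\lambda_k\in[\varepsilon,2-\varepsilon]$, $k\ge0$, for some $\varepsilon\in(0,1)$, and let $$x^{k+1}=x^k+\frac{\lambda_k}{\tau(x^k)}\big(UT(x^k)-x^k\big),\qquad k\ge0.$$ Then $\{x^k\}_{k=0}^\infty$ converges weakly to an element of $\operatorname{Fix}(UT)$.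
   Context: $\mathcal H$ is a real Hilbert space with $\mathcal H\neq\{0\}$; $UT$ denotes the composition $U\circ T$; $\operatorname{Fix}S:=\{z\in\mathcal H:S(z)=z\}$. $S:\mathcal H\to\mathcal H$ is firmly nonexpansive (FNE) if $\langle S(x)-S(y),x-y\rangle\ge\|S(x)-S(y)\|^2$ for all $x,y\in\mathcal H$. For $\lambda>0$, $T$ is $\lambda$-relaxed firmly nonexpansive ($\lambda$-RFNE) if $T=\operatorname{Id}+\lambda(S-\operatorname{Id})$ for some FNE operator $S$. *)

(* Defs.v *)
From HB Require Import structures.
From mathcomp Require Import all_boot all_order all_algebra.
From mathcomp Require Import sesquilinear.
From mathcomp Require Import all_classical all_reals all_analysis.

Set Implicit Arguments.
Unset Strict Implicit.
Unset Printing Implicit Defensive.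

Import Order.TTheory GRing.Theory Num.Theory.
Import numFieldNormedType.Exports.

Local Open Scope classical_set_scope.
Local Open Scope ring_scope.

(* A real inner product: a symmetric positive definite bilinear form that
   induces the norm (over a real field, the hermitian symmetry of [{dot H for
   theta}] is plain symmetry when [theta] is the identity). *)
HB.mixin Record NormedModule_hasInner (R : realType) H & NormedModule R H := {
  inner : {dot H for idfun};
  inner_norm : forall x : H, inner x x = `|x| ^+ 2
}.

#[short(type="hilbertType")]
HB.structure Definition Hilbert (R : realType) :=
  {H of CompleteNormedModule R H & NormedModule_hasInner R H}.

Section Operators.
Context {R : realType} {H : hilbertType R}.
Implicit Types (S T : H -> H) (u : nat -> H) (x y : H).

Definition Fix T : set H := [set z | T z = z].

Definition firmly_nonexpansive S : Prop :=
  forall x y, `|S x - S y| ^+ 2 <= inner (S x - S y) (x - y).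

Definition relaxed_firmly_nonexpansive (lambda : R) T : Prop :=
  exists2 S, firmly_nonexpansive S &
    forall x, T x = x + lambda *: (S x - x).

Definition weakly_cvg u x : Prop :=
  forall y, (fun k => inner (u k) y) @ \oo --> inner x y.

End Operators.

(* Main.v *)
Require Import Defs.
From HB Require Import structures.
From mathcomp Require Import all_boot all_order all_algebra.
From mathcomp Require Import all_classical all_reals all_analysis.
From mathcomp Require Import sesquilinear ring lra.

Set Implicit Arguments.
Unset Strict Implicit.
Unset Printing Implicit Defensive.

Import Order.TTheory GRing.Theory Num.Theory.
Import numFieldNormedType.Exports.

Local Open Scope classical_set_scope.
Local Open Scope ring_scope.

(** Write [V] for [U \o T], [d := x - y], and [a], [b] for the differences at
    [x] and [y] of the displacements of [T] (from the point itself) and of [U]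
    (from its image under [T]). Firm nonexpansiveness of the operators that
    underlie [T] and [U] says exactly that [<d, a> <= - |a|^2 / lambda] and
    [<d + a, b> <= - |b|^2 / mu]; adding,
    [<d, a + b> <= - D] with [D = |a|^2 / lambda + |b|^2 / mu + <a, b>]
    ([comp_displacement]), where [a + b] is the difference of the displacements
    of [V]. For [lambda * mu < 4] the form [D] is positive definite, and
    completing a square gives [D >= |a + b|^2 / nu] with
    [nu = comp_relaxation lambda mu] ([pair_form_ge]).

    Three things follow.
    - For two fixed points of [V], [a + b = 0] and hence [D <= 0], so
      [a = b = 0]: the displacements [T z - z] and [U (T z) - T z] do not depend
      on the fixed point [z] ([comp_fix_displacement]). The lower bound on
      [tau], assumed for one fixed point, therefore holds for all of them.
    - For a fixed point [y], that lower bound turns [<x - y, V x - x> <= - D]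
      into [<x - y, V x - x> <= - |V x - x|^2 / tau x]. With relaxations in
      [[eps, 2 - eps]] and [tau <= nu] every step decreases [|x_k - y|^2] by at
      least [(eps / nu)^2 |V x_k - x_k|^2] ([relaxed_step]). So the distances to
      each fixed point converge and [V x_k - x_k] tends to [0].
    - [Id - V] is [1 / nu]-cocoercive ([comp_cocoercive]), hence demiclosed at
      [0]: weak limits of the iterates along any filter finer than the
      Frechet filter are fixed points ([cocoercive_demiclosed]).

    Opial's argument ([opial]) concludes. The weak compactness that it needs is
    taken along ultrafilters instead of subsequences: along an ultrafilter the
    inner products of a bounded family with any fixed vector converge, the
    limits form a bounded linear functional, and the Riesz representation
    theorem provides the weak limit. *)

(** * Inner product and norm *)

Section InnerProduct.
Context {R : realType} {H : hilbertType R}.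
Implicit Types (x y z u v : H) (a b : R).

Lemma innerC x y : inner x y = inner y x.
Proof. by have := hermC (@inner R H) x y; rewrite expr0 mul1r. Qed.

Lemma innerDl x y z : inner (x + y) z = inner x z + inner y z.
Proof. exact: (linearDl (@inner R H)). Qed.

Lemma innerZl a x y : inner (a *: x) y = a * inner x y.
Proof. exact: (linearZl_LR (@inner R H)). Qed.

Lemma innerNl x y : inner (- x) y = - inner x y.
Proof. exact: (linearNl (@inner R H)). Qed.

Lemma inner0l x : inner 0 x = 0.
Proof. exact: (linear0l (@inner R H)). Qed.

Lemma innerDr x y z : inner z (x + y) = inner z x + inner z y.
Proof. by rewrite innerC innerDl !(innerC z). Qed.

Lemma innerZr a x y : inner y (a *: x) = a * inner y x.
Proof. by rewrite innerC innerZl innerC. Qed.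

Lemma innerNr x y : inner y (- x) = - inner y x.
Proof. by rewrite innerC innerNl innerC. Qed.

Definition innerE :=
  (innerDl, innerDr, innerNl, innerNr, innerZl, innerZr).

Lemma inner_ge0 x : 0 <= inner x x.
Proof. by rewrite inner_norm exprn_ge0. Qed.

(** The vector [<y, y> x - <x, y> y] is [<y, y>] times the component of [x]
    orthogonal to [y]; its squared norm is [<y, y>] times the difference of
    the squares of the two sides. *)
Lemma inner_CauchySchwarz x y : `|inner x y| <= `|x| * `|y|.
Proof.
have [->|y0] := eqVneq y 0; first by rewrite innerC inner0l normr0 mulr_ge0.
have yy_gt0 : 0 < inner y y by rewrite inner_norm exprn_gt0 // normr_gt0.
rewrite -ler_sqr ?nnegrE ?mulr_ge0 // exprMn -!inner_norm.
rewrite real_normK ?num_real //.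
have := inner_ge0 (inner y y *: x - inner x y *: y).
rewrite !innerE (innerC y x) => h.
rewrite -subr_ge0 -(pmulr_rge0 _ yy_gt0); move: h; congr (0 <= _); ring.
Qed.

End InnerProduct.

(** * Riesz representation and weak limits *)

(** First-order optimality: near [0] the linear term dominates. *)
Lemma quad_ge0_linear0 (R : realFieldType) (d q : R) :
  (forall t, 0 <= 2 * t * d + t ^+ 2 * q) -> d = 0.
Proof.
move=> quad_ge0; pose r := `|q| + 1.
have r_gt0 : 0 < r by rewrite ltr_wpDl.
have q_ler : q <= r by rewrite /r; have := ler_norm q; lra.
(* At [- d / r] the quadratic is at most [- d ^+ 2 / r]. *)
have := quad_ge0 (- d / r).
have -> : 2 * (- d / r) * d + (- d / r) ^+ 2 * q
  = (d / r) ^+ 2 * (q - 2 * r) by field; rewrite gt_eqF.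
rewrite nmulr_lge0 => [|]; last by lra.
rewrite le_eqVlt ltNge sqr_ge0 orbF sqrf_eq0 mulf_eq0 invr_eq0 (gt_eqF r_gt0).
by rewrite orbF => /eqP.
Qed.

Section WeakLimits.
Context {R : realType} {H : hilbertType R}.
Implicit Types (x y z u v : H) (a b : R).

Lemma cvg_inner_bounded0 (I : Type) (F : set_system I) {FF : Filter F}
    (u v : I -> H) (C : R) :
  (forall i, `|u i| <= C) -> v i @[i --> F] --> 0 ->
  inner (u i) (v i) @[i --> F] --> 0.
Proof.
move=> uC v0; apply/norm_cvg0P.
apply: (@squeeze_cvgr _ _ _ _ (cst 0) (fun i => C * `|v i|)).
- apply: nearW => i; rewrite normr_ge0 /=.
  by apply: le_trans (inner_CauchySchwarz _ _) _; rewrite ler_wpM2r.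
- exact: cvg_cst.
- rewrite -(mulr0 C) -(@normr0 _ H); apply: cvgM; first exact: cvg_cst.
  exact: cvg_norm.
Qed.

Lemma cvg_innerl (I : Type) (F : set_system I) {FF : Filter F}
    (u : I -> H) x y :
  u i @[i --> F] --> x -> inner (u i) y @[i --> F] --> inner x y.
Proof.
move=> ux; apply/subr_cvg0.
have : inner y (u i - x) @[i --> F] --> 0.
  apply: (@cvg_inner_bounded0 _ _ _ _ _ `|y|) => //.
  by rewrite -(subrr x); apply: cvgB => //; exact: cvg_cst.
by under eq_fun do rewrite innerDr innerNr ![inner y _]innerC.
Qed.

(** The representing vector is the minimiser of [J y = <y, y> - 2 L y]. By the
    parallelogram law a minimising sequence is Cauchy, and the first variation
    of [J] at its limit [x] in the direction [h] is [2 (<x, h> - L h)]. *)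
Theorem riesz_representation (L : H -> R) (C : R) : scalar L ->
  (forall y, `|L y| <= C * `|y|) -> exists x, forall y, L y = inner x y.
Proof.
move=> linL bdL.
have LD u v : L (u + v) = L u + L v.
  by have := linL 1 u v; rewrite scale1r mul1r.
have L0 : L 0 = 0 by apply: (addrI (L 0)); rewrite -LD !addr0.
have LZ a u : L (a *: u) = a * L u.
  by have := linL a u 0; rewrite !addr0 L0 addr0.
pose J y := inner y y - 2 * L y.
have Jparallelogram u v :
    inner (u - v) (u - v) = 2 * J u + 2 * J v - 4 * J (2^-1 *: (u + v)).
  by rewrite /J !innerE !LZ !LD (innerC v u); field.
have J_lb : has_inf (range J).
  split; first by exists (J 0), 0.
  exists (- C ^+ 2) => _ [y _ <-]; rewrite /J inner_norm.
  (* [|y|^2 - 2 C |y| >= - C^2]. *)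
  have := ler_norm (L y); have := bdL y; have := sqr_ge0 (`|y| - C); lra.
pose m := inf (range J).
have m_le y : m <= J y by apply: ge_inf; [case: J_lb | exists y].
have /choice[y_ y_min] (n : nat) : exists y, J y < m + harmonic n.
  have n_gt0 : 0 < harmonic n :> R by rewrite /harmonic /= invr_gt0.
  have [_ [y _ <-] ?] := @inf_adherent _ _ (harmonic n) n_gt0 J_lb.
  by exists y.
have y_close n p : `|y_ n - y_ p| ^+ 2 <= 2 * harmonic n + 2 * harmonic p.
  rewrite -inner_norm Jparallelogram.
  have := m_le (2^-1 *: (y_ n + y_ p)).
  have := y_min n; have := y_min p; lra.
have /cvg_ex[x y_x] : cvgn y_.
  apply/cauchy_cvgP/cauchy_exP => e e_gt0.
  have e2 : 0 < e ^+ 2 / 4 by rewrite divr_gt0 // exprn_gt0.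
  have [N _ N_e] := cvgr_lt _ (@cvg_harmonic R) _ e2.
  exists (y_ N), N => // n /= Nn; rewrite -ball_normE /ball_ /=.
  rewrite -ltr_sqr ?nnegrE ?(ltW e_gt0) //; apply: le_lt_trans (y_close N n) _.
  have hN : harmonic N < e ^+ 2 / 4 := N_e _ (leqnn N).
  have hn : harmonic n < e ^+ 2 / 4 := N_e _ Nn.
  move: hN hn; lra.
exists x => h.
(* [y_ n] minimises [J] up to [harmonic n], so this quadratic, with [y_ n] for
   [x], is at least [- harmonic n]. *)
have quad_ge0 t : 0 <= 2 * t * (inner x h - L h) + t ^+ 2 * inner h h.
  apply: (@ler_cvg_to _ \oo _ R (fun n => - harmonic n)
    (fun n => 2 * t * (inner (y_ n) h - L h) + t ^+ 2 * inner h h) 0).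
  - by rewrite -oppr0; apply: cvgN; exact: cvg_harmonic.
  - apply: cvgD; last exact: cvg_cst.
    apply: cvgM; first exact: cvg_cst.
    by apply: cvgB; [exact: cvg_innerl | exact: cvg_cst].
  apply: nearW => n; have := m_le (y_ n + t *: h); have := y_min n.
  rewrite /J !innerE LD LZ (innerC h); lra.
by apply/esym/subr0_eq; exact: quad_ge0_linear0 quad_ge0.
Qed.

(** A cluster point, which exists by compactness, is a limit: an ultrafilter
    contains each set or its complement. *)
Lemma real_ultra_cvg (I : Type) (F : set_system I) (f : I -> R) (C : R) :
  UltraFilter F -> (forall i, `|f i| <= C) -> cvg (f @ F).
Proof.
move=> UF fC.
have [p [_ clp]] : `[- C, C] `&` cluster (f @ F) !=set0.
  apply: segment_compact; apply: nearW => i /=.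
  by rewrite in_itv /= -ler_norml.
apply/cvg_ex; exists p => V pV.
have [//|FV] := in_ultra_setVsetC (f @^-1` V) UF.
by have [q []] := clp (~` V) V FV pV.
Qed.

(** Weak compactness of balls: the limits of the inner products with [y] depend
    on [y] linearly and are bounded by [C * `|y|], so a vector represents them. *)
Lemma ultra_weak_limit (I : Type) (F : set_system I) (u : I -> H) (C : R) :
  UltraFilter F -> (forall i, `|u i| <= C) ->
  exists x, forall y, inner (u i) y @[i --> F] --> inner x y.
Proof.
move=> UF uC.
have /choice[L cvgL] (y : H) : exists l : R, inner (u i) y @[i --> F] --> l.
  apply/cvg_ex/(@real_ultra_cvg _ _ _ (C * `|y|)) => // i.
  by apply: le_trans (inner_CauchySchwarz _ _) _; rewrite ler_wpM2r.
have [|y|x Lx] := @riesz_representation L C.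
- move=> a y z; apply: (cvg_unique _ (cvgL _)) => //=.
  under eq_fun do rewrite innerDr innerZr.
  by apply: cvgD => //; apply: cvgM => //; exact: cvg_cst.
- apply: cvgr_to_le (cvg_norm (cvgL y)) _; apply: nearW => i.
  by apply: le_trans (inner_CauchySchwarz _ _) _; rewrite ler_wpM2r.
by exists x => y; rewrite -Lx.
Qed.

(** If [x] and [x'] in [C] are weak limits along two filters finer than [\oo],
    polarisation expresses [<u k, x - x'>] through the squared distances to [x]
    and [x'], so it has a limit along [\oo]. That limit is both [<x, x - x'>]
    and [<x', x - x'>], whence [x = x']. All ultrafilters thus give the same
    weak limit, and this is convergence along [\oo]: were it to fail for
    [y], an ultrafilter finer than [\oo] would contain the set of indices [k]
    with [<u k, y>] outside some neighbourhood of [<x, y>]. *)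
Theorem opial (u : nat -> H) (M : R) (C : set H) :
  (forall k, `|u k| <= M) ->
  (forall z, C z -> cvg (`|u k - z| ^+ 2 @[k --> \oo])) ->
  (forall (F : set_system nat) x, ProperFilter F -> \oo `<=` F ->
     (forall y, inner (u k) y @[k --> F] --> inner x y) -> C x) ->
  exists2 x, C x & weakly_cvg u x.
Proof.
move=> uM dist_cvg weak_lim_C.
have weak_lim (F : set_system nat) : UltraFilter F -> \oo `<=` F ->
    exists2 x, C x & forall y, inner (u k) y @[k --> F] --> inner x y.
  move=> UF ooF; have [x ux] := @ultra_weak_limit _ _ u M UF uM.
  by exists x => //; exact: weak_lim_C ux.
have inner_cvg z z' : C z -> C z' -> cvg (inner (u k) (z - z') @[k --> \oo]).
  move=> Cz Cz'; have [/cvg_ex[l ul] /cvg_ex[l' ul']] :=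
    (dist_cvg z Cz, dist_cvg z' Cz').
  apply/cvg_ex; exists (2^-1 * (l' - l + (inner z z - inner z' z'))).
  have -> : (fun k => inner (u k) (z - z')) = fun k =>
    2^-1 * (`|u k - z'| ^+ 2 - `|u k - z| ^+ 2 + (inner z z - inner z' z')).
    apply/funext => k; rewrite -!inner_norm !innerE.
    by rewrite (innerC z) (innerC z'); field.
  apply: cvgM; first exact: cvg_cst.
  by apply: cvgD; [exact: cvgB | exact: cvg_cst].
have [F0 [UF0 ooF0]] := @ultraFilterLemma _ \oo _.
have [x Cx ux] := weak_lim _ UF0 ooF0.
exists x => // y V Vxy; apply: contrapT => nooV.
pose B : set nat := (fun k => inner (u k) y) @^-1` V.
have [F [UF ooF]] : exists F, UltraFilter F /\ within (~` B) \oo `<=` F.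
  apply: ultraFilterLemma; apply: Build_ProperFilter_ex => A.
  rewrite /within => ooA; apply: contrapT => A0; apply: nooV.
  suff: \oo B by [].
  apply: (@filterS _ \oo _ _ _ _ ooA) => k Ak; apply: contrapT => nBk.
  by apply: A0; exists k; exact: Ak.
have ooF' : \oo `<=` F by move=> A ooA; apply/ooF; exact: filterS ooA.
have [x' Cx' ux'] := weak_lim _ UF ooF'.
have xx' : x' = x.
  have /cvg_ex[l ul] := inner_cvg _ _ Cx Cx'.
  have lx : l = inner x (x - x').
    apply: (cvg_unique _ _ (ux _)) => //.
    by apply: cvg_trans ul; exact: cvg_app.
  have lx' : l = inner x' (x - x').
    apply: (cvg_unique _ _ (ux' _)) => //.
    by apply: cvg_trans ul; exact: cvg_app.
  apply/esym/subr0_eq/eqP; rewrite -normr_eq0 -sqrf_eq0 -inner_norm.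
  by rewrite {1}innerDl innerNl -lx -lx' subrr.
have FB : F B by apply: ux'; rewrite xx'.
have FnB : F (~` B) by apply: ooF; apply: nearW.
by have [k []] := filter_ex (filterI FB FnB).
Qed.

End WeakLimits.

(** * Displacements of relaxed firmly nonexpansive operators *)

Section RelaxedOperators.
Context {R : realType} {H : hilbertType R}.
Implicit Types (x y z u v : H) (lambda mu nu : R) (S T U : H -> H).

(** With [S] the underlying operator, the difference of displacements is
    [lambda] times [s = (S x - S y) - (x - y)], and firm nonexpansiveness of [S]
    reads [<s, s> + <s, x - y> <= 0]. *)
Lemma rfne_displacement lambda T x y :
  0 < lambda -> relaxed_firmly_nonexpansive lambda T ->
  inner (x - y) ((T x - x) - (T y - y)) <=
    - (lambda^-1 * `|(T x - x) - (T y - y)| ^+ 2).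
Proof.
move=> l0 [S fneS TE].
pose s := S x - S y - (x - y).
have -> : T x - x - (T y - y) = lambda *: s.
  rewrite !TE (addrC x) addrK (addrC y) addrK -scalerBr.
  by rewrite /s !opprD !opprK addrACA.
have := fneS x y; have -> : S x - S y = s + (x - y) by rewrite subrK.
move: (x - y) s => d s; rewrite -!inner_norm !innerE (innerC d s).
move=> fne_sd.
have : lambda * (inner s s + inner s d) <= 0 by rewrite pmulr_rle0 //; lra.
have -> : lambda^-1 * (lambda * (lambda * inner s s)) = lambda * inner s s.
  by rewrite mulKf // gt_eqF.
lra.
Qed.

(** The denominator in the lower bound on the step parameter [tau]. *)
Definition pair_form (lambda mu : R) (a b : H) : R :=
  lambda^-1 * `|a| ^+ 2 + mu^-1 * `|b| ^+ 2 + inner a b.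

(** [T x - T y] is [x - y] plus the difference of the displacements of [T];
    the cross term of [pair_form] comes from there. *)
Lemma comp_displacement lambda mu T U x y :
  0 < lambda -> 0 < mu ->
  relaxed_firmly_nonexpansive lambda T -> relaxed_firmly_nonexpansive mu U ->
  inner (x - y) ((U (T x) - x) - (U (T y) - y)) <=
    - pair_form lambda mu ((T x - x) - (T y - y))
        ((U (T x) - T x) - (U (T y) - T y)).
Proof.
move=> l0 m0 rT rU; rewrite /pair_form.
have := rfne_displacement x y l0 rT.
have := rfne_displacement (T x) (T y) m0 rU.
rewrite !innerE; lra.
Qed.

(** [lambda + mu] is at least twice the square root [r] of [lambda * mu], and
    [2 r > r ^+ 2] since [r < 2]. *)
Lemma relaxation_sum_gt0 (lambda mu : R) :
  0 < lambda -> 0 < mu -> lambda * mu < 4 -> 0 < lambda + mu - lambda * mu.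
Proof.
move=> l0 m0 lm4.
have lm0 := mulr_gt0 l0 m0; have := sqr_ge0 (lambda - mu).
rewrite -subr_gt0 in lm4; have := mulr_gt0 lm0 lm4 => h1 h2.
rewrite ltNge; apply/negP => h; nra.
Qed.

Definition comp_relaxation lambda mu : R :=
  4 * (lambda + mu - lambda * mu) / (4 - lambda * mu).

Lemma comp_relaxation_gt0 lambda mu :
  0 < lambda -> 0 < mu -> lambda * mu < 4 -> 0 < comp_relaxation lambda mu.
Proof.
move=> l0 m0 lm4; apply: divr_gt0; last by rewrite subr_gt0.
by rewrite mulr_gt0 // relaxation_sum_gt0.
Qed.

(** The difference of the two sides is a nonnegative multiple of the squared
    norm of [mu (2 - lambda) a - lambda (2 - mu) b]. In other words, the
    constant is the largest value of [`|a + b| ^+ 2] on the unit sphere of the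
    form (in a nonzero space), which is how it becomes the relaxation parameter
    of a composition. *)
Lemma pair_form_ge (lambda mu : R) (a b : H) :
  0 < lambda -> 0 < mu -> lambda * mu < 4 ->
  `|a + b| ^+ 2 / comp_relaxation lambda mu <=
    pair_form lambda mu a b.
Proof.
move=> l0 m0 lm4; have S_gt0 := relaxation_sum_gt0 l0 m0 lm4.
have lm_gt0 : 0 < 4 - lambda * mu by rewrite subr_gt0.
rewrite -subr_ge0 /pair_form /comp_relaxation.
have := inner_ge0 ((mu * (2 - lambda)) *: a - (lambda * (2 - mu)) *: b).
set sq := inner _ _ => sq_ge0.
have scale_gt0 : 0 < (4 * lambda * mu * (lambda + mu - lambda * mu))^-1.
  by rewrite invr_gt0 !mulr_gt0.
move: (mulr_ge0 (ltW scale_gt0) sq_ge0); rewrite /sq.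
rewrite -!inner_norm !innerE (innerC b a); congr (0 <= _).
by field; rewrite !gt_eqF.
Qed.

Lemma pair_form_comp_ge lambda mu T U x y :
  0 < lambda -> 0 < mu -> lambda * mu < 4 ->
  `|(U (T x) - x) - (U (T y) - y)| ^+ 2 /
      comp_relaxation lambda mu <=
    pair_form lambda mu ((T x - x) - (T y - y))
      ((U (T x) - T x) - (U (T y) - T y)).
Proof.
move=> l0 m0 lm4; apply: le_trans (pair_form_ge _ _ l0 m0 lm4).
by rewrite addrACA -opprD ![T _ - _ + _]addrC !subrKA.
Qed.

Lemma comp_cocoercive lambda mu T U x y :
  0 < lambda -> 0 < mu -> lambda * mu < 4 ->
  relaxed_firmly_nonexpansive lambda T -> relaxed_firmly_nonexpansive mu U ->
  inner (x - y) ((U (T x) - x) - (U (T y) - y)) <=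
    - (`|(U (T x) - x) - (U (T y) - y)| ^+ 2 /
       comp_relaxation lambda mu).
Proof.
move=> l0 m0 lm4 rT rU; apply: le_trans (comp_displacement x y l0 m0 rT rU) _.
by rewrite lerN2 pair_form_comp_ge.
Qed.

(** For two fixed points the displacements of [U] are opposite to those of [T],
    so that [pair_form] reduces to a positive multiple of [`|a| ^+ 2], while
    [comp_displacement] says that it is nonpositive. *)
Lemma comp_fix_displacement lambda mu T U x y :
  0 < lambda -> 0 < mu -> lambda * mu < 4 ->
  relaxed_firmly_nonexpansive lambda T -> relaxed_firmly_nonexpansive mu U ->
  U (T x) = x -> U (T y) = y -> T x - x = T y - y.
Proof.
move=> l0 m0 lm4 rT rU xE yE.
have := comp_displacement x y l0 m0 rT rU; rewrite xE yE !subrr innerC inner0l.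
have -> : x - T x - (y - T y) = - (T x - x - (T y - y)).
  by rewrite -(opprB (T x) x) -(opprB (T y) y) opprK addrC [RHS]opprB.
rewrite oppr_ge0 /pair_form normrN innerNr inner_norm => h.
have c_gt0 : 0 < lambda^-1 + mu^-1 - 1.
  have -> : lambda^-1 + mu^-1 - 1 = (lambda + mu - lambda * mu) / (lambda * mu).
    by field; rewrite !gt_eqF.
  by rewrite divr_gt0 ?mulr_gt0 // relaxation_sum_gt0.
apply/subr0_eq/eqP; rewrite -normr_eq0 -sqrf_eq0 eq_le exprn_ge0 // andbT.
rewrite -(pmulr_rle0 _ c_gt0); lra.
Qed.

(** * Relaxed steps and demiclosedness *)

(** Expanding the square, the decrease is at least
    [l (2 - l) / t ^+ 2 * `|v| ^+ 2], in which both factors [l] and [2 - l] are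
    at least [eps]. *)
Lemma relaxed_step x z v (l t nu eps : R) :
  0 < t <= nu -> 0 < eps -> eps <= l <= 2 - eps ->
  inner (x - z) v <= - (`|v| ^+ 2 / t) ->
  `|x + (l / t) *: v - z| ^+ 2 <= `|x - z| ^+ 2 - (eps / nu) ^+ 2 * `|v| ^+ 2.
Proof.
move=> /andP[t0 t_nu] e0 /andP[el l2e].
rewrite [x + _ - z]addrAC; move: (x - z) => d.
rewrite -!inner_norm !innerE (innerC v d).
have := inner_ge0 v.
move: (inner d d) (inner v v) (inner d v) => dd q dv q_ge0 dv_le.
have nu_gt0 : 0 < nu := lt_le_trans t0 t_nu.
have l_gt0 : 0 < l := lt_le_trans e0 el.
have lt_gt0 : 0 < l / t by rewrite divr_gt0.
have step_le : l / t * dv <= l / t * - (q / t) by rewrite ler_pM2l.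
have coef_le : (eps / nu) ^+ 2 <= l * (2 - l) / t ^+ 2.
  rewrite expr_div_n; apply: ler_pM; rewrite ?invr_ge0 ?sqr_ge0 //.
    by rewrite expr2; apply: ler_pM; lra.
  by rewrite lef_pV2 ?posrE ?exprn_gt0 // ler_sqr ?nnegrE // ltW.
have := ler_wpM2r q_ge0 coef_le.
have -> : l * (2 - l) / t ^+ 2 * q =
    - 2 * (l / t * - (q / t)) - l / t * (l / t * q).
  by field; exact: lt0r_neq0.
lra.
Qed.

(** Cocoercivity between [u i] and [x] bounds [`|g i - w| ^+ 2 / nu] by
    [<u i - x, w> - <u i - x, g i>], where [g i] and [w] are the displacements
    of [V] at [u i] and [x]. The first product vanishes in the limit by weak
    convergence, the second because [g i] tends to [0] and [u] is bounded. *)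
Lemma cocoercive_demiclosed (V : H -> H) (nu M : R) (I : Type) (F : set_system I)
    (u : I -> H) x : ProperFilter F -> 0 < nu ->
  (forall y z, inner (y - z) ((V y - y) - (V z - z)) <=
     - (`|(V y - y) - (V z - z)| ^+ 2 / nu)) ->
  (forall i, `|u i| <= M) ->
  (forall y, inner (u i) y @[i --> F] --> inner x y) ->
  V (u i) - u i @[i --> F] --> 0 -> V x = x.
Proof.
move=> PF nu0 cocoV uM ux Vu0; apply/subr0_eq/eqP.
rewrite -normr_eq0 -sqrf_eq0 eq_le exprn_ge0 // andbT.
have nuV_gt0 : 0 < nu^-1 by rewrite invr_gt0.
rewrite -(pmulr_lle0 _ nuV_gt0).
pose g i := V (u i) - u i; set w := V x - x.
have g_cvg (y : I -> H) C :
    (forall i, `|y i| <= C) -> inner (y i) (g i) @[i --> F] --> 0.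
  by move=> yC; exact: cvg_inner_bounded0 yC Vu0.
have lhs_cvg : `|g i - w| ^+ 2 / nu + (inner (u i) (g i) - inner x (g i)) -
    (inner (u i) w - inner x w) @[i --> F] -->
    `|w| ^+ 2 / nu + (0 - 0) - (inner x w - inner x w).
  apply: cvgB; last by apply: cvgB => //; exact: cvg_cst.
  apply: cvgD; last first.
    by apply: cvgB; [exact: g_cvg uM | exact: (g_cvg (cst x) `|x|)].
  apply: cvgM; last exact: cvg_cst.
  have gw : g i - w @[i --> F] --> 0 - w.
    by apply: cvgB => //; exact: cvg_cst.
  have := cvg_norm gw; rewrite sub0r normrN => ngw.
  under eq_fun do rewrite expr2.
  by rewrite expr2; apply: cvgM; exact: ngw.
move: lhs_cvg; rewrite !subrr addr0 subr0 => /cvgr_to_le; apply.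
apply: nearW => i; have := cocoV (u i) x.
rewrite -/w -/(g i) !innerE; lra.
Qed.

End RelaxedOperators.

(** * Convergence of the iteration *)

Theorem theorem4p1 (R : realType) (H : hilbertType R)
  (H_nontrivial : exists v : H, v != 0)
  (lambda mu : R) (lambda_gt0 : 0 < lambda) (mu_gt0 : 0 < mu)
  (lambda_mu_lt4 : lambda * mu < 4)
  (T U : H -> H)
  (T_rfne : relaxed_firmly_nonexpansive lambda T)
  (U_rfne : relaxed_firmly_nonexpansive mu U)
  (Fix_UT_neq0 : Fix (U \o T) !=set0)
  (tau : H -> R) (tau_gt0 : forall x, 0 < tau x)
  (tau_bounds : exists2 z, Fix (U \o T) z &
    forall x, ~ Fix (U \o T) x ->
      let nu_star := 4 * (lambda + mu - lambda * mu) / (4 - lambda * mu) in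
      let a1 := T x - x in
      let a2 := T z - z in
      let b1 := (U \o T) x - T x in
      let b2 := (U \o T) z - T z in
      `|a1 + b1| ^+ 2 /
        (lambda^-1 * `|a1 - a2| ^+ 2 + mu^-1 * `|b1 - b2| ^+ 2
         + inner (a1 - a2) (b1 - b2))
      <= tau x <= nu_star)
  (x0 : H) (eps : R) (eps_gt0 : 0 < eps) (eps_lt1 : eps < 1)
  (lambda_ : nat -> R) (lambda_bounds : forall k, eps <= lambda_ k <= 2 - eps)
  (x_ : nat -> H) (x_0 : x_ 0%N = x0)
  (x_S : forall k, x_ k.+1 =
    x_ k + (lambda_ k / tau (x_ k)) *: ((U \o T) (x_ k) - x_ k)) :
  exists2 xlim, Fix (U \o T) xlim & weakly_cvg x_ xlim.
Proof.
have [z Fz tauz] := tau_bounds; set V := U \o T.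
pose nu := comp_relaxation lambda mu.
have nu_gt0 : 0 < nu by exact: comp_relaxation_gt0.
have cocoV x y : inner (x - y) ((V x - x) - (V y - y)) <=
    - (`|(V x - x) - (V y - y)| ^+ 2 / nu).
  exact: (comp_cocoercive x y lambda_gt0 mu_gt0 lambda_mu_lt4 T_rfne U_rfne).
have fejer (y : H) k : Fix V y ->
    `|x_ k.+1 - y| ^+ 2 <=
    `|x_ k - y| ^+ 2 - (eps / nu) ^+ 2 * `|V (x_ k) - x_ k| ^+ 2.
  move=> Fy; rewrite x_S; have [Fx|nFx] := pselect (Fix V (x_ k)).
    have -> : (U \o T) (x_ k) = x_ k := Fx.
    have -> : V (x_ k) = x_ k := Fx.
    by rewrite subrr scaler0 addr0 normr0 expr0n mulr0 subr0.
  have [tau_ge tau_le] := andP (tauz _ nFx).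
  apply: relaxed_step => //; first by rewrite tau_gt0.
  (* The bound on [tau] is known at [z] only; it is carried over to [y]. *)
  have same_disp : T y - y = T z - z.
    exact: (comp_fix_displacement lambda_gt0 mu_gt0 lambda_mu_lt4 T_rfne U_rfne).
  have {}Fy : U (T y) = y := Fy; have {}Fz : U (T z) = z := Fz.
  have same_disp' : U (T y) - T y = U (T z) - T z.
    by rewrite Fy Fz -opprB same_disp opprB.
  have := comp_displacement (x_ k) y lambda_gt0 mu_gt0 T_rfne U_rfne.
  have := pair_form_comp_ge T U (x_ k) y lambda_gt0 mu_gt0 lambda_mu_lt4.
  move: tau_ge; rewrite addrC subrKA /= -same_disp -same_disp' Fy subrr !subr0.
  rewrite -/(pair_form lambda mu _ _) -/nu; set D := pair_form _ _ _ _.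
  move=> tau_ge D_ge /le_trans; apply; rewrite lerN2.
  have D_gt0 : 0 < D.
    apply: lt_le_trans D_ge; rewrite divr_gt0 // exprn_gt0 // normr_gt0.
    by rewrite subr_eq0; apply/eqP.
  by rewrite ler_pdivrMr // mulrC -ler_pdivrMr.
have dist_ni y : Fix V y ->
    {homo (fun k => `|x_ k - y| ^+ 2) : n m / (n <= m)%N >-> m <= n}.
  move=> Fy; apply/nonincreasing_seqP => k; apply: le_trans (fejer y k Fy) _.
  by rewrite gerBl mulr_ge0 // sqr_ge0.
have dist_cvg y : Fix V y -> cvg (`|x_ k - y| ^+ 2 @[k --> \oo]).
  move=> Fy; apply: nonincreasing_is_cvgn; first exact: dist_ni.
  by exists 0 => _ [k _ <-]; rewrite exprn_ge0.
have x_bd k : `|x_ k| <= `|x_ 0%N - z| + `|z|.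
  rewrite -{1}(subrK z (x_ k)); apply: le_trans (ler_normD _ _) _.
  by rewrite lerD2r -ler_sqr ?nnegrE //; exact: dist_ni.
have res0 : V (x_ k) - x_ k @[k --> \oo] --> 0.
  have /cvg_ex[l dist_l] := dist_cvg z Fz.
  have decr0 : `|x_ k - z| ^+ 2 - `|x_ k.+1 - z| ^+ 2 @[k --> \oo] --> 0.
    by rewrite -(subrr l); apply: cvgB => //; rewrite -cvg_shiftS in dist_l.
  apply/cvgr0Pnorm_lt => e e_gt0.
  have en_gt0 : 0 < (eps / nu) ^+ 2 by rewrite exprn_gt0 // divr_gt0.
  have bd_gt0 := mulr_gt0 en_gt0 (exprn_gt0 2 e_gt0).
  apply: filterS (cvgr_lt _ decr0 _ bd_gt0) => k small.
  rewrite -ltr_sqr ?nnegrE ?(ltW e_gt0) //.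
  rewrite -(ltr_pM2l en_gt0); have := fejer z k Fz; lra.
have [x Fx ux] := opial x_bd dist_cvg (fun F x PF ooF ux =>
  cocoercive_demiclosed PF nu_gt0 cocoV x_bd ux (cvg_trans (cvg_app _ ooF) res0)).
by exists x.
Qed.
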